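(* Let $d$ be a negative integer and $e:=|d|$. Then, as formal power series in $x$, $$L_e(x,1)=\sum_{n\geq1}\frac{\displaystyle\sum_{2i_2+3i_3+\cdots+(e+1)i_{e+1}=n-1}\binom{n}{i_2,\ldots,i_{e+1}}x^{n-i_2-\cdots-i_{e+1}}\,t^{\,i_{e+1}}\prod_{j=2}^{e}\left(x\binom{e+2}{j}-\binom{e}{j-1}\right)^{i_j}}{n(1-(e+2)x)^n},$$ where the inner sum runs over nonnegative integers $i_2,\dots,i_{e+1}$ with $\sum_{j=2}^{e+1} j\,i_j=n-1$, $$\binom{n}{i_2,\ldots,i_{e+1}}=\frac{n!}{i_2!\cdots i_{e+1}!\,(n-i_2-\cdots-i_{e+1})!}\quad\text{and}\quad t=\frac{(e+2)x(1-x)-1+x(1+x)}{1-x}.$$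
   Context: A Dyck path is a lattice path in the first quadrant that starts at the origin, ends on the $x$-axis, and consists of steps $U=(1,1)$ and $D=(1,-1)$ (never going below the $x$-axis). Its semi-length is its number of $U$ steps. A valley is an occurrence of two consecutive steps $DU$; the level of a valley is the $y$-coordinate of its lowest point. Let $\nu=(\nu_1,\dots,\nu_k)$ be the levels of all valleys of $P$, listed from left to right. For $d\in\mathbb Z$, a Dyck path is called $d$-Dyck if it has at most one valley or if $\nu_{i+1}-\nu_i\ge d$ for all $1\le i<k$. For $d<0$ and $e=|d|$, $L_e(x,1)=\sum_{n\ge 1}r_d(n)x^n$, where $r_d(n)$ is the number of $d$-Dyck paths of semi-length $n$ (the empty path is not counted). *)

(* Defs.v *)
From HB Require Import structures.
From mathcomp Require Import all_boot all_order all_algebra.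
From mathcomp Require Import boolp.

Set Implicit Arguments.
Unset Strict Implicit.
Unset Printing Implicit Defensive.

Import Order.TTheory GRing.Theory Num.Theory.
Local Open Scope ring_scope.

(** * Formal power series in one variable *)

Record fps (R : Type) : Type := FPS { coef_fps :> nat -> R }.
Notation "{ 'fps' R }" := (fps R) (at level 0, format "{ 'fps'  R }") : type_scope.

HB.instance Definition _ (R : Type) := gen_eqMixin {fps R}.
HB.instance Definition _ (R : Type) := gen_choiceMixin {fps R}.

Lemma fpsP (R : Type) (f g : {fps R}) : f =1 g -> f = g.
Proof. by case: f g => [f] [g] /= /funext ->. Qed.

Section FpsRing.
Variable R : comNzRingType.
Implicit Types f g h : {fps R}.

Definition fps_const (c : R) : {fps R} := FPS (fun n => if n == 0%N then c else 0).
Definition fps_add f g : {fps R} := FPS (fun n => f n + g n).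
Definition fps_opp f : {fps R} := FPS (fun n => - f n).
Definition fps_mul f g : {fps R} :=
  FPS (fun n => \sum_(j < n.+1) f j * g (n - j)%N).

Lemma fps_addA : associative fps_add.
Proof. by move=> f g h; apply: fpsP => n /=; rewrite addrA. Qed.
Lemma fps_addC : commutative fps_add.
Proof. by move=> f g; apply: fpsP => n /=; rewrite addrC. Qed.
Lemma fps_add0 : left_id (fps_const 0) fps_add.
Proof. by move=> f; apply: fpsP => n /=; rewrite if_same add0r. Qed.
Lemma fps_addN : left_inverse (fps_const 0) fps_opp fps_add.
Proof. by move=> f; apply: fpsP => n /=; rewrite if_same addNr. Qed.

HB.instance Definition _ :=
  GRing.isZmodule.Build {fps R} fps_addA fps_addC fps_add0 fps_addN.

Definition fps_trunc (N : nat) f : {poly R} := \poly_(i < N) f i.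

Lemma fps_mul_trunc N f g n :
  (n < N)%N -> fps_mul f g n = (fps_trunc N f * fps_trunc N g)`_n.
Proof.
move=> nN; rewrite coefM /=; apply: eq_bigr => j _; rewrite !coef_poly.
have jn : (j <= n)%N by rewrite -ltnS.
by rewrite (leq_ltn_trans jn nN) (leq_ltn_trans (leq_subr _ _) nN).
Qed.

Lemma fps_mulC : commutative fps_mul.
Proof.
by move=> f g; apply: fpsP => n; rewrite !(fps_mul_trunc _ _ (ltnSn n)) mulrC.
Qed.

Lemma fps_mulA : associative fps_mul.
Proof.
move=> f g h; apply: fpsP => n.
transitivity ((fps_trunc n.+1 f * (fps_trunc n.+1 g * fps_trunc n.+1 h))`_n).
  rewrite coefM; apply: eq_bigr => j _.
  by rewrite coef_poly ltn_ord -(fps_mul_trunc _ _ (N := n.+1)) // ltnS leq_subr.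
rewrite mulrA coefM; apply: eq_bigr => j _.
by rewrite -fps_mul_trunc ?coef_poly ?ltn_ord // ltnS leq_subr.
Qed.

Lemma fps_mul1 : left_id (fps_const 1) fps_mul.
Proof.
move=> f; apply: fpsP => n /=; rewrite big_ord_recl /= mul1r subn0.
by rewrite big1 ?addr0 // => j _; rewrite mul0r.
Qed.

Lemma fps_mulDl : left_distributive fps_mul fps_add.
Proof.
move=> f g h; apply: fpsP => n /=; rewrite -big_split /=.
by apply: eq_bigr => j _; rewrite mulrDl.
Qed.

Lemma fps_one_neq0 : fps_const 1 != 0 :> {fps R}.
Proof.
by apply/eqP => /(congr1 (fun f : {fps R} => f 0%N)) /eqP /=; rewrite oner_eq0.
Qed.

HB.instance Definition _ := GRing.Zmodule_isComNzRing.Build {fps R}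
  fps_mulA fps_mulC fps_mul1 fps_mulDl fps_one_neq0.

Definition fps_unit : pred {fps R} := fun f => `[< exists g, g * f = 1 >].

(* As for every unitRingType, f^-1 = f when f is not invertible. *)
Definition fps_inv f : {fps R} :=
  if pselect (exists g, g * f = 1) is left ex then projT1 (cid ex) else f.

Lemma fps_mulVf : {in fps_unit, left_inverse 1 fps_inv *%R}.
Proof.
move=> f /asboolP uf; rewrite /fps_inv; case: pselect => // ex.
by case: (cid ex).
Qed.

Lemma fps_unitPl f g : g * f = 1 -> fps_unit f.
Proof. by move=> gf; apply/asboolP; exists g. Qed.

Lemma fps_inv_out : {in [predC fps_unit], fps_inv =1 id}.
Proof.
by move=> f /asboolPn nuf; rewrite /fps_inv; case: pselect => // /nuf.
Qed.

HB.instance Definition _ := GRing.ComNzRing_hasMulInverse.Build {fps R}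
  fps_mulVf fps_unitPl fps_inv_out.

Definition fpsX : {fps R} := FPS (fun n => (n == 1%N)%:R).

(* Convergence of the series \sum_(n >= 1) u n to f in the X-adic topology:
   each coefficient of the partial sums is eventually equal to that of f. *)
Definition fps_has_sum1 (u : nat -> {fps R}) f : Prop :=
  forall m : nat, exists N : nat, forall M : nat, (N <= M)%N ->
    (\sum_(1 <= n < M) u n) m = f m.

End FpsRing.

Lemma fps_unitE (R : comUnitRingType) (f : {fps R}) :
  (f \is a GRing.unit) = (f 0%N \is a GRing.unit).
Proof.
apply/idP/idP => [uf|uf0].
  have /(congr1 (fun h : {fps R} => h 0%N)) /= := mulVr uf.
  rewrite big_ord_recl big_ord0 addr0 subn0 => fV.
  by apply/unitrPr; exists ((f^-1 : {fps R}) 0%N); rewrite mulrC.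
pose step (s : seq R) := rcons s
  (if size s == 0%N then (f 0%N)^-1
   else - (f 0%N)^-1 * \sum_(j < size s) s`_j * f (size s - j)%N).
pose T n := iter n step [::].
have sT n : size (T n) = n by elim: n => //= n IH; rewrite size_rcons IH.
have nT n k : (n <= k)%N -> forall j, (j < n)%N -> (T k)`_j = (T n)`_j.
  move=> /subnK <-; elim: (k - n)%N => // i IH j jn.
  by rewrite addSn /= nth_rcons sT ltn_addl // IH.
pose g : {fps R} := FPS (fun n => (T n.+1)`_n).
apply/asboolP; exists g; apply: fpsP => n.
change (\sum_(j < n.+1) g j * f (n - j)%N = if n == 0%N then 1 else 0).
rewrite big_ord_recr subnn /= nth_rcons sT ltnn eqxx.
case: n => [|n] /=; first by rewrite big_ord0 add0r mulVr.
rewrite mulrAC mulNr mulVr // mulN1r; apply/eqP; rewrite subr_eq0; apply/eqP.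
by apply: eq_bigr => j _; rewrite -(nT j.+1 n.+1) ?ltn_ord.
Qed.

(** * Dyck paths *)

(* A lattice path is its word of steps: U = true is (1,1), D = false is (1,-1). *)
Notation step := bool (only parsing).
Definition U : step := true.
Definition D : step := false.

(* The prefix [take k w] ends at the point (k, height (take k w)). *)
Definition height (w : seq step) : int := (count_mem U w)%:Z - (count_mem D w)%:Z.

Definition is_dyck (w : seq step) : bool :=
  all (fun k => 0 <= height (take k w)) (iota 0 (size w).+1) && (height w == 0).

Definition semilength (w : seq step) : nat := count_mem U w.

(* The default values of [nth] are never used: both positions are < size w. *)
Definition valley_levels (w : seq step) : seq int :=
  [seq height (take k.+1 w) |
     k <- iota 0 (size w).-1 & (nth U w k == D) && (nth U w k.+1 == U)].

(* [sorted] compares consecutive entries, and holds for lists of size <= 1. *)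
Definition is_dDyck (d : int) (w : seq step) : bool :=
  is_dyck w && sorted (fun a b : int => d <= b - a) (valley_levels w).

Lemma size_dyck (w : seq step) : is_dyck w -> size w = (semilength w).*2.
Proof.
case/andP=> _; rewrite /height /semilength subr_eq0 => /eqP [UD].
rewrite -(count_predC (pred1 U) w) -addnn; congr addn; rewrite {}UD.
by apply: eq_count; case.
Qed.

(* By size_dyck, all Dyck paths of semi-length n are words of length 2n. *)
Definition num_dDyck (d : int) (n : nat) : nat :=
  #|[set w : (n.*2).-tuple step | is_dDyck d w && (semilength w == n)]|.

(* L_e(x,1), for e = |d| *)
Definition L_series (d : int) : {fps rat} :=
  FPS (fun n => if n == 0%N then 0 else (num_dDyck d n)%:R).

(** * The terms of the series *)

Section Terms.
Variable e : nat.

Local Notation x := (fpsX rat).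

Definition t_series : {fps rat} :=
  ((e + 2)%:R * x * (1 - x) - 1 + x * (1 + x)) / (1 - x).

(* A tuple (i_2, ..., i_(e+1)) is coded by a function i on {0, ..., e+1} with
   i_0 = i_1 = 0; the values may be bounded by n - 1 since j * i_j <= n - 1. *)
Definition admissible (n : nat) (i : {ffun 'I_e.+2 -> 'I_n}) : bool :=
  [forall (j : 'I_e.+2 | (j < 2)%N), i j == 0%N :> nat] &&
  (\sum_(j < e.+2 | (2 <= j)%N) j * i j == n.-1)%N.

Definition isum (n : nat) (i : {ffun 'I_e.+2 -> 'I_n}) : nat :=
  (\sum_(j < e.+2 | (2 <= j)%N) i j)%N.

Definition multinom (n : nat) (i : {ffun 'I_e.+2 -> 'I_n}) : {fps rat} :=
  (n`!)%:R / ((\prod_(j < e.+2 | (2 <= j)%N) (i j)`!) * (n - isum i)`!)%:R.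

Definition summand (n : nat) : {fps rat} :=
  (\sum_(i : {ffun 'I_e.+2 -> 'I_n} | admissible i)
      multinom i * x ^+ (n - isum i) * t_series ^+ (i ord_max) *
      \prod_(j < e.+2 | (2 <= j <= e)%N)
         (x * 'C(e + 2, j)%:R - 'C(e, j.-1)%:R) ^+ (i j))
  / (n%:R * (1 - (e + 2)%:R * x) ^+ n).

End Terms.

(* Main.v *)
From HB Require Import structures.
Require Import Defs.
From mathcomp Require Import all_boot all_order all_algebra.
From mathcomp Require Import zify ring.
Set Implicit Arguments.
Unset Strict Implicit.
Unset Printing Implicit Defensive.
Import Order.TTheory GRing.Theory Num.Theory.
Local Open Scope ring_scope.

(** Write [L] for the generating function of the nonempty [d]-Dyck paths and
    let [phi] be the polynomial in [z] over [Q[[x]]] given by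
    [(1 - (e+2)x) phi(z) =
       x + sum_(2 <= j <= e) (x C(e+2,j) - C(e,j-1)) z^j + t z^(e+1)].
    By the multinomial theorem the [n]-th term of the series is
    [(1/n) [z^(n-1)] phi^n] (lemma [summandE]), so the theorem says that the
    Lagrange series of [phi] is [L].

    The Lagrange series.  Put [a(n,k) = (k/n) [z^(n-k)] phi^n].  Differentiating
    [phi^(n+1)] gives [a(n+1,k+1) = sum_j phi_j a(n,k+j)] ([lagrange_coefS]).
    Since [phi_1 = 0] and [x] divides [phi_0], the coefficient of [z^i] in
    [phi^n] is divisible by [x^m] as soon as [2m + i <= 2n].  Hence
    [A(k) = sum_n a(n,k)] converges, is divisible by [x^k], and satisfies
    [A(k+1) = sum_j phi_j A(k+j)], a system whose solutions with
    [x^k] dividing [A(k)] are determined by [A(0)] ([shifted_rec_unique]).  Applied to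
    [A(m+k) - A(m) A(k)] this uniqueness yields [A(k) = A(1)^k], so [A(1)] is a
    fixed point of [phi]; the existence of the fixed point comes for free.

    The paths.  Reading a path from left to right, it suffices to remember the
    last step, the current height and the level of the last valley; the start
    counts as a valley of level 0, which imposes no constraint.  Let [H_w] count
    the prefixes that end with a down step at height [w] (or are empty) and may
    be followed by an up step, that is, whose last valley is at level at most
    [w + e].  Then [(1-x) H_w = (1-x) [w = 0] +
    sum_(v <= w+e) x^(max(w,v)+1-v) H_v] ([valley_gf_rec]), and these equations
    determine all the [H_w].  When [s] satisfies the kernel equation
    [(1-x)(s-x) = x s + x (s-x) (s + ... + s^e)],
    the solution is [x H_w = x [w = 0] + (s - x) s^w] ([valley_gfE]), and summing
    over the last valley of a complete path gives [1 + L = 1/(1-s)].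

    Finally, [A = phi(A)] turns out to be the kernel equation for
    [s = A/(1+A)] ([fixpoint_equation], [kernel_equation]), and then
    [1/(1-s) = 1 + A], so [L = A]. *)

(** * Order of formal power series *)

Section Order.
Variable R : comNzRingType.
Implicit Types f g : {fps R}.
Local Notation x := (fpsX R).

Lemma fps_sumE (I : Type) (r : seq I) (P : pred I) (F : I -> {fps R}) n :
  (\sum_(i <- r | P i) F i) n = \sum_(i <- r | P i) F i n.
Proof. by elim/big_rec2: _ => [|i y1 y2 _ <-] //=; case: n. Qed.

Lemma fps_mulE f g n : (f * g) n = \sum_(j < n.+1) f j * g (n - j)%N.
Proof. by []. Qed.

Lemma fps_natE k n : (k%:R : {fps R}) n = if n == 0%N then k%:R else 0.
Proof.
elim: k => [|k IH]; first by case: n.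
rewrite -!natr1; change ((k%:R : {fps R}) n + (1 : {fps R}) n = if n == 0%N then k%:R + 1 else 0).
by rewrite IH; case: n {IH} => //= n; rewrite addr0.
Qed.

Lemma fps_XmulE f n : (x * f) n = if n is m.+1 then f m else 0.
Proof.
rewrite fps_mulE big_ord_recl /= mul0r add0r; case: n => [|n]; first by rewrite big_ord0.
rewrite big_ord_recl /= mul1r subSS subn0 big1 ?addr0 // => j _.
by rewrite mul0r.
Qed.

(** [fps_ord m f]: the series [f] is divisible by [X^m], expressed on its
    coefficients. *)
Definition fps_ord m f : Prop := forall i, (i < m)%N -> f i = 0.

Lemma fps_ord0 f : fps_ord 0 f. Proof. by []. Qed.
Lemma fps_ordW m k f : fps_ord k f -> (m <= k)%N -> fps_ord m f.
Proof. by move=> fk mk i im; apply: fk; apply: leq_trans mk. Qed.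
Lemma fps_ord_0 m : fps_ord m 0.
Proof. by move=> [|i]. Qed.
Lemma fps_ordD m f g : fps_ord m f -> fps_ord m g -> fps_ord m (f + g).
Proof.
move=> fm gm i im; change (f i + g i = 0); by rewrite fm ?gm ?addr0.
Qed.
Lemma fps_ordN m f : fps_ord m f -> fps_ord m (- f).
Proof. by move=> fm i im; change (- f i = 0); rewrite fm ?oppr0. Qed.
Lemma fps_ordB m f g : fps_ord m f -> fps_ord m g -> fps_ord m (f - g).
Proof. by move=> fm gm; apply: fps_ordD => //; apply: fps_ordN. Qed.
Lemma fps_ordM m k f g : fps_ord m f -> fps_ord k g -> fps_ord (m + k) (f * g).
Proof.
move=> fm gk i im; rewrite fps_mulE big1 // => j _.
have [jm|mj] := ltnP j m; first by rewrite fm ?mul0r.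
by rewrite gk ?mulr0 //; have := ltn_ord j; lia.
Qed.
Lemma fps_ordMl m f g : fps_ord m g -> fps_ord m (f * g).
Proof. exact: (@fps_ordM 0). Qed.
Lemma fps_ordX m k f : fps_ord m f -> fps_ord (m * k) (f ^+ k).
Proof.
move=> fm; elim: k => [|k IH]; first by rewrite muln0.
by rewrite exprS mulnS; apply: fps_ordM.
Qed.
Lemma fps_ord_sum m (I : Type) (r : seq I) (P : pred I) (F : I -> {fps R}) :
  (forall i, P i -> fps_ord m (F i)) -> fps_ord m (\sum_(i <- r | P i) F i).
Proof.
move=> Fm; elim/big_ind: _ => //; [exact: fps_ord_0 | exact: fps_ordD].
Qed.
Lemma fps_ord_x : fps_ord 1 x.
Proof. by case. Qed.
Lemma fps_ord_xn k : fps_ord k (x ^+ k).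
Proof. by rewrite -[k in fps_ord k]mul1n; apply: fps_ordX; exact: fps_ord_x. Qed.
Lemma fps_ord_eq0 f : (forall m, fps_ord m f) -> f = 0.
Proof. by move=> fm; apply: fpsP => n; rewrite (fm n.+1) //; case: n. Qed.
Lemma fps_ord_eq m f g i : fps_ord m (f - g) -> (i < m)%N -> f i = g i.
Proof.
by move=> fg im; apply/eqP; rewrite -subr_eq0; apply/eqP; exact: (fg i im).
Qed.
End Order.

Lemma sum_ord_widen (V : zmodType) (f : nat -> V) (m n : nat) :
  (forall j, (m <= j)%N -> f j = 0) -> (forall j, (n <= j)%N -> f j = 0) ->
  \sum_(j < m) f j = \sum_(j < n) f j.
Proof.
wlog mn : m n / (m <= n)%N.
  by move=> H hm hn; have [/H->|/ltnW/H <-] := leqP m n.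
move=> hm _; rewrite (big_ord_widen _ f mn) [RHS](bigID (fun j : 'I_n => (j < m)%N)) /=.
by rewrite [X in _ + X]big1 ?addr0 // => j; rewrite -leqNgt => /hm.
Qed.

Lemma fps_unit_1BX (F : fieldType) (f : {fps F}) : 1 - f * fpsX F \is a GRing.unit.
Proof.
rewrite fps_unitE unitfE.
suff -> : (1 - f * fpsX F) 0%N = 1 by rewrite oner_eq0.
by change (1 - (f * fpsX F) 0%N = 1); rewrite mulrC fps_XmulE subr0.
Qed.

(** * Lagrange inversion at parameter 1 *)

Section Lagrange.
Variable F : numFieldType.
Local Notation R := {fps F}.
Variable phi : {poly R}.

Lemma fps_nat_unit n : (n.+1%:R : R) \is a GRing.unit.
Proof. by rewrite fps_unitE fps_natE unitfE pnatr_eq0. Qed.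

(** [lagrange_coef n k] is [(k/n) [z^(n-k)] phi^n], the coefficient of [u^n] in
    the [k]-th power of the solution [f] of [f = u phi(f)]; hence the value
    [[k = 0]] at [n = 0]. *)
Definition lagrange_coef (n k : nat) : R :=
  if n == 0%N then (k == 0%N)%:R
  else if (k <= n)%N then k%:R / n%:R * (phi ^+ n)`_(n - k) else 0.

(** This is the coefficient form of [f^(k+1) = f^k * (u phi(f))]. *)
Lemma lagrange_coefS n k :
  lagrange_coef n.+1 k.+1 = \sum_(j < size phi) phi`_j * lagrange_coef n (k + j).
Proof.
have phi0 j : (size phi <= j)%N -> phi`_j = 0 by move=> /(nth_default 0).
rewrite {1}/lagrange_coef /= ltnS subSS.
have -> : \sum_(j < size phi) phi`_j * lagrange_coef n (k + j)
    = \sum_(j < maxn (size phi) n.+1) phi`_j * lagrange_coef n (k + j).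
  apply: (@sum_ord_widen _ (fun j => phi`_j * lagrange_coef n (k + j))).
    by move=> j /phi0 ->; rewrite mul0r.
  by move=> j; rewrite geq_max => /andP[/phi0 -> _]; rewrite mul0r.
case: n => [|n].
  rewrite (@sum_ord_widen _ (fun j => phi`_j * lagrange_coef 0 (k + j)) _ 1).
  - rewrite big_ord1 /lagrange_coef /= addn0 leqn0.
    by case: eqP => [->|_]; rewrite ?mulr0 // divr1 mul1r expr1 mulr1.
  - by move=> j; rewrite geq_max => /andP[/phi0 -> _]; rewrite mul0r.
  - move=> j j0; rewrite /lagrange_coef /= addn_eq0.
    by case: j j0 => //= j _; rewrite andbF mulr0.
case: leqP => [kn|nk]; last first.
  rewrite big1 // => j _; rewrite /lagrange_coef /= ifN ?mulr0 //.
  by rewrite -ltnNge; lia.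
set i := (n.+1 - k)%N.
(* both sides after multiplication by (n+1)(n+2) *)
apply: (mulrI (fps_nat_unit n)); apply: (mulrI (fps_nat_unit n.+1)).
pose p := phi ^+ n.+1.
have conv : (phi * p)`_i =
    \sum_(j < maxn (size phi) n.+2)
       phi`_j * (if (j <= i)%N then p`_(i - j) else 0).
  rewrite coefM.
  under eq_bigr => j _ do [rewrite (_ : p`_(i - j) =
    if (j <= i)%N then p`_(i - j) else 0); last by rewrite -ltnS ltn_ord].
  apply: (@sum_ord_widen _ (fun j => phi`_j * (if (j <= i)%N then p`_(i - j) else 0))).
    by move=> j ij; rewrite ifN ?mulr0 // -ltnNge.
  by move=> j; rewrite geq_max => /andP[/phi0 -> _]; rewrite mul0r.
have dconv : ('X * phi^`() * p)`_i =
    \sum_(j < maxn (size phi) n.+2)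
       phi`_j *+ j * (if (j <= i)%N then p`_(i - j) else 0).
  have Xd j : ('X * phi^`())`_j = phi`_j *+ j.
    by rewrite coefXM; case: j => [|j] //=; rewrite coef_deriv.
  rewrite coefM.
  under eq_bigr => j _ do [rewrite Xd (_ : p`_(i - j) =
    if (j <= i)%N then p`_(i - j) else 0); last by rewrite -ltnS ltn_ord].
  apply: (@sum_ord_widen _ (fun j => phi`_j *+ j * (if (j <= i)%N then p`_(i - j) else 0))).
    by move=> j ij; rewrite ifN ?mulr0 // -ltnNge.
  by move=> j; rewrite geq_max => /andP[/phi0 -> _]; rewrite mul0rn mul0r.
(* From (phi^(n+2))' = (n+2) phi' phi^(n+1): this converts the factor j of the
   sum into the degree i. *)
have der : n.+2%:R * ('X * phi^`() * p)`_i = i%:R * (phi ^+ n.+2)`_i.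
  have -> : i%:R * (phi ^+ n.+2)`_i = ('X * (phi ^+ n.+2)^`())`_i.
    by rewrite coefXM; case: i {conv dconv} => [|i] /=; rewrite ?mul0r // coef_deriv mulr_natl.
  by rewrite deriv_exp /= mulrnAr coefMn mulr_natl -/p mulrA.
have sum_eq : n.+1%:R * (\sum_(j < maxn (size phi) n.+2) phi`_j * lagrange_coef n.+1 (k + j)) =
   k%:R * (phi * p)`_i + ('X * phi^`() * p)`_i.
  rewrite conv dconv !big_distrr -big_split; apply: eq_bigr => j _ /=.
  rewrite /lagrange_coef /= -/p.
  have -> : (k + j <= n.+1)%N = (j <= i)%N by rewrite /i; lia.
  case: ifP => ji; last by rewrite !mulr0 addr0.
  have -> : (n.+1 - (k + j) = i - j)%N by rewrite /i; lia.
  rewrite natrD -[phi`_j *+ j]mulr_natr.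
  have := mulVr (fps_nat_unit n).
  move: (n.+1%:R) => N; move: (N^-1) => v vN. ring: vN.
rewrite sum_eq mulrDr der -exprS mulrA.
have ki : i%:R = n.+1%:R - k%:R :> R by rewrite /i natrB.
rewrite ki.
have := mulVr (fps_nat_unit n.+1); rewrite -(natr1 n.+1) -(natr1 k).
move: (n.+1%:R) ((phi ^+ n.+2)`_i) k%:R (_^-1) => N q K v vN.
transitivity ((v * (N + 1)) * (K + 1) * N * q); first by ring.
by rewrite vN; ring.
Qed.

Hypothesis phi_0 : fps_ord 1 phi`_0.
Hypothesis phi_1 : phi`_1 = 0.

(** Each factor contributing degree 0 in [z] brings a factor [X], and the other
    ones contribute degree at least 2 since [phi_1 = 0]. *)
Lemma coef_pow_ord n i m : (m.*2 + i <= n.*2)%N -> fps_ord m (phi ^+ n)`_i.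
Proof.
elim: n i m => [|n IH] i m mi.
  by have -> : m = 0%N by lia.
rewrite exprS coefM; apply: fps_ord_sum => -[[|[|j]] /= ji] _.
- case: m mi => [|m] mi; first exact: fps_ord0.
  rewrite subn0 -add1n; apply: fps_ordM => //; apply: IH; lia.
- rewrite phi_1 mul0r; exact: fps_ord_0.
- apply: fps_ordMl; apply: IH; lia.
Qed.

Lemma lagrange_coef_ord n k m :
  (m.*2 <= n + k)%N -> fps_ord m (lagrange_coef n k).
Proof.
rewrite /lagrange_coef; case: n => [|n] /= mnk.
  case: k mnk => [|k] mnk; last exact: fps_ord_0.
  by have -> : m = 0%N by lia.
case: leqP => kn; last exact: fps_ord_0.
apply: fps_ordMl; apply: coef_pow_ord; lia.
Qed.

Lemma lagrange_coef_ordk n k : fps_ord k (lagrange_coef n k).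
Proof.
have [kn|nk] := leqP k n; first by apply: lagrange_coef_ord; lia.
rewrite /lagrange_coef leqNgt nk /=; case: n nk => [|n] nk /=; last exact: fps_ord_0.
by case: k nk => // k _; exact: fps_ord_0.
Qed.

(** The X-adic sum over [n] of [lagrange_coef n k]: by [lagrange_coef_ord], the
    coefficient of index [m] only sees the terms with [n < 2m + 2]. *)
Definition lagrange_sum (k : nat) : R :=
  FPS (fun m => (\sum_(n < m.*2.+2) lagrange_coef n k) m).

Lemma lagrange_sum_approx k M N :
  (M.*2 <= N)%N -> fps_ord M (lagrange_sum k - \sum_(n < N) lagrange_coef n k).
Proof.
move=> MN i iM.
change ((\sum_(n < i.*2.+2) lagrange_coef n k) i
  - (\sum_(n < N) lagrange_coef n k) i = 0).
apply/eqP; rewrite subr_eq0; apply/eqP; rewrite !fps_sumE.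
have iN : (i.*2.+2 <= N)%N by lia.
rewrite (big_ord_widen _ (fun n => lagrange_coef n k i) iN).
rewrite [RHS](bigID (fun n : 'I_N => (n < i.*2.+2)%N)) /=.
rewrite [X in _ + X]big1 ?addr0 // => n; rewrite -leqNgt => ni.
by apply: (@lagrange_coef_ord n k i.+1) => //; lia.
Qed.

Lemma lagrange_sum_ord k : fps_ord k (lagrange_sum k).
Proof.
move=> i ik; rewrite /= fps_sumE big1 // => n _.
exact: lagrange_coef_ordk.
Qed.

Lemma lagrange_coefn0 n : lagrange_coef n 0 = (n == 0%N)%:R.
Proof. by case: n => // n; rewrite /lagrange_coef !mul0r. Qed.

Lemma lagrange_sum0 : lagrange_sum 0 = 1.
Proof.
apply: fpsP => m; rewrite [LHS]fps_sumE big_ord_recl big1 ?addr0 => [|j _].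
  by rewrite lagrange_coefn0.
by rewrite lagrange_coefn0; case: m j.
Qed.

Lemma lagrange_sumS k :
  lagrange_sum k.+1 = \sum_(j < size phi) phi`_j * lagrange_sum (k + j).
Proof.
apply/eqP; rewrite -subr_eq0; apply/eqP; apply: fps_ord_eq0 => M.
have E : \sum_(n < M.*2.+1) lagrange_coef n k.+1
    = \sum_(j < size phi) phi`_j * \sum_(n < M.*2) lagrange_coef n (k + j).
  rewrite big_ord_recl add0r.
  under eq_bigr => n _ do rewrite lagrange_coefS.
  by rewrite exchange_big; apply: eq_bigr => j _; rewrite big_distrr.
set S := \sum_(n < M.*2.+1) _ in E; set f := lagrange_sum k.+1.
have -> : f - \sum_(j < size phi) phi`_j * lagrange_sum (k + j) = (f - S)
    - \sum_(j < size phi) phi`_j * (lagrange_sum (k + j) - \sum_(n < M.*2) lagrange_coef n (k + j)).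
  rewrite [X in _ = _ - X](eq_bigr _ (fun j _ => mulrBr _ _ _)).
  by rewrite sumrB -E opprB addrA subrK.
apply: fps_ordB; first by apply: lagrange_sum_approx; lia.
apply: fps_ord_sum => j _; apply: fps_ordMl; exact: lagrange_sum_approx.
Qed.

(** Uniqueness for the system satisfied by [lagrange_sum]: as [phi_0] is divisible
    by [X] and [phi_1 = 0], the divisibility of [A k] by [X^(k+m)] for all [k]
    improves to divisibility by [X^(k+m+1)]. *)
Lemma shifted_rec_unique (A : nat -> R) :
  A 0%N = 0 -> (forall k, fps_ord k (A k)) ->
  (forall k, A k.+1 = \sum_(j < size phi) phi`_j * A (k + j)%N) ->
  forall k, A k = 0.
Proof.
move=> A0 Ak AS.
suff H m k : fps_ord (k + m) (A k).
  by move=> k; apply: fps_ord_eq0 => m; apply: (fps_ordW (H m k)); lia.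
elim: m k => [|m IHm] k; first by rewrite addn0.
elim: k => [|k IHk]; first by rewrite A0; exact: fps_ord_0.
rewrite AS; apply: fps_ord_sum => -[[|[|j]] /= _] _.
- by rewrite addn0; apply: (fps_ordM phi_0 IHk).
- by rewrite phi_1 mul0r; exact: fps_ord_0.
- by apply: fps_ordMl; apply: (fps_ordW (IHm _)); lia.
Qed.

(** For fixed [m], both sides solve the recurrence of [lagrange_sumS] in [k] with
    the same initial value. *)
Lemma lagrange_sumD m k : lagrange_sum (m + k) = lagrange_sum m * lagrange_sum k.
Proof.
apply/eqP; rewrite -subr_eq0; apply/eqP.
pose B k := lagrange_sum (m + k) - lagrange_sum m * lagrange_sum k.
apply: (@shifted_rec_unique B); rewrite {}/B => {k}.
- by rewrite addn0 lagrange_sum0 mulr1 subrr.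
- move=> k; cbv beta; apply: fps_ordB; first by apply: (fps_ordW (@lagrange_sum_ord _)); lia.
  by apply: fps_ordMl; exact: lagrange_sum_ord.
- move=> k; rewrite addnS !lagrange_sumS big_distrr -sumrB.
  by apply: eq_bigr => j _; rewrite addnA mulrBr mulrCA.
Qed.

Lemma lagrange_sumX k : lagrange_sum k = lagrange_sum 1 ^+ k.
Proof.
elim: k => [|k IH]; first by rewrite lagrange_sum0.
by rewrite -add1n lagrange_sumD IH exprS.
Qed.

Lemma lagrange_fixpoint : lagrange_sum 1 = phi.[lagrange_sum 1].
Proof.
rewrite horner_coef {1}lagrange_sumS; apply: eq_bigr => j _.
by rewrite add0n lagrange_sumX.
Qed.

Lemma lagrange_has_sum : fps_has_sum1 (lagrange_coef^~ 1%N) (lagrange_sum 1).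
Proof.
move=> m; exists m.*2.+2 => M mM.
have -> : \sum_(1 <= n < M) lagrange_coef n 1 = \sum_(n < M) lagrange_coef n 1.
  case: M mM => // M _.
  by rewrite big_add1 big_mkord big_ord_recl add0r.
apply/esym/(@fps_ord_eq _ m.+1) => //.
by apply: lagrange_sum_approx; lia.
Qed.

End Lagrange.

(** * The multinomial theorem and the terms of the series *)

Section Multinomial.
Variables (R : comUnitRingType) (A : comAlgType R) (N : nat).
Hypothesis nat_unit : forall n, (n.+1%:R : R) \is a GRing.unit.

Lemma fact_unit n : (n`!%:R : R) \is a GRing.unit.
Proof. by rewrite -[n`!]prednK ?fact_gt0. Qed.

(** The exponential of [a] times the indeterminate, truncated to the
    degrees below [N]. *)
Definition trunc_exp (a : A) : {poly A} := \poly_(k < N) (k`!%:R^-1 *: a ^+ k).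

Lemma coef_prod_trunc_exp (I : Type) (r : seq I) (y : I -> A) k : (k < N)%N ->
  (\prod_(i <- r) trunc_exp (y i))`_k = k`!%:R^-1 *: (\sum_(i <- r) y i) ^+ k.
Proof.
elim: r k => [|i r IH] k kN.
  rewrite !big_nil coef1 expr0n; case: k {kN} => [|k] /=; last by rewrite scaler0.
  by rewrite invr1 scale1r.
rewrite !big_cons coefM addrC exprDn scaler_sumr; apply: eq_bigr => j _.
have jk : (j <= k)%N by rewrite -ltnS.
rewrite coef_poly (leq_ltn_trans jk kN) IH ?(leq_ltn_trans (leq_subr _ _) kN) //.
rewrite -scalerAl -scalerAr scalerA -scaler_nat scalerA mulrC; congr (_ *: _); last exact: mulrC.
apply: (mulrI (fact_unit k)); rewrite mulrA divrr ?fact_unit // mul1r.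
rewrite -{1}(bin_fact jk) !natrM.
have := mulVr (fact_unit j); have := mulVr (fact_unit (k - j)).
move: (j`!%:R) ((k - j)`!%:R) => a b; move: a^-1 b^-1 => a' b' bb aa.
by transitivity ('C(k, j)%:R * (a' * a) * (b' * b)); [ring | rewrite aa bb !mulr1].
Qed.

(** The multinomial theorem, with exponents bounded by [N], obtained by expanding
    the product of the exponentials of the [y i]. *)
Lemma multinomial (I : finType) (y : I -> A) k : (k < N)%N ->
  k`!%:R^-1 *: (\sum_i y i) ^+ k =
  \sum_(f : {ffun I -> 'I_N} | (\sum_i f i == k)%N)
     \prod_i ((f i)`!%:R^-1 *: y i ^+ f i).
Proof.
move=> kN; rewrite -coef_prod_trunc_exp //.
under eq_bigr do rewrite /trunc_exp poly_def.
rewrite bigA_distr_bigA coef_sum [RHS]big_mkcond; apply: eq_bigr => f _.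
have -> : \prod_i (((f i)`!%:R^-1 *: y i ^+ f i) *: 'X^(f i))
  = (\prod_i ((f i)`!%:R^-1 *: y i ^+ f i)) *: 'X^(\sum_i f i)%N :> {poly A}.
  by rewrite scaler_prod prodrXr.
rewrite coefZ coefXn eq_sym; case: eqP => _; by rewrite ?mulr1 ?mulr0.
Qed.
End Multinomial.

Section Summand.
Variable e : nat.
Hypothesis e_gt0 : (0 < e)%N.
Local Notation x := (fpsX rat).
Local Notation R := {fps rat}.

(** The coefficient of [z^j] in [(1 - (e+2)x) phi(z)], for [1 <= j <= e+1]; the
    constant coefficient is kept apart, and replaced by 0. *)
Definition gcoef (j : nat) : R :=
  if (j < 2)%N then 0 else if j == e.+1 then t_series e
  else x * 'C(e + 2, j)%:R - 'C(e, j.-1)%:R.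

(** The part of positive degree of [(1 - (e+2)x) phi(z)]. *)
Definition nonconst_poly : {poly R} := \sum_(j < e.+2) gcoef j *: 'X^j.

(** The polynomial [phi] whose Lagrange series is the series of the theorem. *)
Definition phi_poly : {poly R} := (1 - (e + 2)%:R * x)^-1 *: (x%:P + nonconst_poly).

Lemma coef_nonconst_poly_exp n k : (k < n)%N -> (nonconst_poly ^+ k)`_n.-1 =
  k`!%:R * \sum_(i : {ffun 'I_e.+2 -> 'I_n} | admissible i && (isum i == k))
    \prod_(j < e.+2) ((i j)`!%:R^-1 * gcoef j ^+ i j).
Proof.
move=> kn.
have /(congr1 (fun p : {poly R} => k`!%:R * p`_n.-1)) :=
  @multinomial {fps rat} {poly R} n (@fps_nat_unit rat) _ (fun j : 'I_e.+2 => gcoef j *: 'X^j) k kn.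
rewrite coefZ mulVKr ?fact_unit //; last exact: fps_nat_unit.
rewrite -/nonconst_poly => ->; congr (_ * _).
rewrite coef_sum big_mkcond [RHS]big_mkcond; apply: eq_bigr => i _.
have -> : \prod_(j < e.+2) ((i j)`!%:R^-1 *: (gcoef j *: 'X^j) ^+ i j)
   = (\prod_(j < e.+2) ((i j)`!%:R^-1 * gcoef j ^+ i j))
     *: 'X^(\sum_(j < e.+2) j * i j)%N :> {poly R}.
  under eq_bigr do rewrite exprZn scalerA -exprM.
  by rewrite scaler_prod prodrXr.
(* An exponent tuple with i_0 or i_1 nonzero contributes 0, as gcoef is 0 there. *)
have [i01|i01] := boolP [forall (j : 'I_e.+2 | (j < 2)%N), i j == 0%N :> nat]; last first.
  rewrite /admissible (negbTE i01) /=.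
  move: i01; rewrite negb_forall => /existsP[j]; rewrite negb_imply => /andP[j2 ij].
  rewrite [\prod_(_ < _) _](bigD1 j) //= {1}/gcoef j2 expr0n (negbTE ij) mulr0 mul0r scale0r coef0.
  by rewrite if_same.
have ij0 (j : 'I_e.+2) : (j < 2)%N -> i j = 0%N :> nat.
  by move=> j2; have /forallP/(_ j)/implyP/(_ j2)/eqP := i01.
have sum2 (G : 'I_e.+2 -> nat) : (forall j, i j = 0%N :> nat -> G j = 0%N) ->
   (\sum_(j < e.+2) G j = \sum_(j < e.+2 | (2 <= j)%N) G j)%N.
  move=> G0; rewrite [RHS]big_mkcond; apply: eq_bigr => j _.
  by case: leqP => // /ij0/G0.
rewrite /admissible i01 /= /isum -!sum2 // => [|j ->]; last by rewrite muln0.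
rewrite coefZ coefXn [_ == n.-1]eq_sym; case: (_ == k); case: (_ == _); by rewrite ?mulr1 ?mulr0.
Qed.

(** In the expansion of the power [n+1] of [x + nonconst_poly], the last summand, the
    only one where an exponent could reach [n+1], does not contribute in degree [n]. *)
Lemma coef_nonconst_poly_expS n : (nonconst_poly ^+ n.+1)`_n = 0.
Proof.
have [q ->] : exists q, nonconst_poly = 'X^2 * q.
  exists (\sum_(j < e.+2) gcoef j *: 'X^(j - 2)); rewrite mulr_sumr.
  apply: eq_bigr => j _; rewrite -scalerAr -exprD.
  rewrite /gcoef; case: ltnP => j2; first by rewrite !scale0r.
  by rewrite subnKC.
by rewrite exprMn -exprM coefXnM ifT //; lia.
Qed.

Lemma summandE n : summand e n.+1 = lagrange_coef phi_poly n.+1 1.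
Proof.
rewrite /lagrange_coef /= subn1 /= exprZn coefZ.
have cu := fps_unit_1BX ((e + 2)%:R : R).
rewrite /summand invrM ?unitrX ?fps_nat_unit // -exprVn mul1r.
rewrite [RHS]mulrA [RHS]mulrC; congr (_ * _); last exact: mulrC.
rewrite exprDn coef_sum big_ord_recr /= subnn expr0 mul1r binn mulr1n.
rewrite coef_nonconst_poly_expS addr0.
(* Both sides are graded by the number k of factors taken in nonconst_poly;
   it is at most n, so inord does not truncate it. *)
rewrite (partition_big (fun i : {ffun 'I_e.+2 -> 'I_n.+1} => inord (isum i) : 'I_n.+1) predT) //=.
apply: eq_bigr => k _.
rewrite coefMn -polyC_exp coefCM (@coef_nonconst_poly_exp n.+1 k) //.
rewrite -[_ *+ 'C(_, _)]mulr_natr mulrA mulrAC mulr_sumr.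
have isum_le (i : {ffun 'I_e.+2 -> 'I_n.+1}) : admissible i -> (isum i <= n)%N.
  case/andP=> _ /eqP /= {2}<-; rewrite /isum; apply: leq_sum => j j2.
  by rewrite leq_pmull // (leq_trans _ j2).
have isum_eq (i : {ffun 'I_e.+2 -> 'I_n.+1}) : admissible i ->
    (inord (isum i) == k) = (isum i == k).
  by move=> /isum_le ik; rewrite -val_eqE /= inordK.
apply: eq_big => [i|i /andP[ai]].
  by case ai: (admissible i) => //=; exact: isum_eq.
rewrite isum_eq // => /eqP ik.
rewrite /multinom ik.
have split_prod (G : 'I_e.+2 -> R) : (forall j : 'I_e.+2, (j < 2)%N -> G j = 1) ->
    \prod_(j < e.+2) G j = G ord_max * \prod_(j < e.+2 | (2 <= j <= e)%N) G j.
  move=> G1; rewrite (bigD1 ord_max) //=; congr (_ * _).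
  rewrite big_mkcond [RHS]big_mkcond; apply: eq_bigr => j _.
  rewrite -val_eqE /=; have := ltn_ord j.
  case: eqP => [->|jn] /= je; first by rewrite ltnn andbF.
  have [j2|j2] := ltnP j 2; first by rewrite G1.
  by rewrite ifT //; lia.
have ij0 (j : 'I_e.+2) : (j < 2)%N -> i j = 0%N :> nat.
  by move=> j2; case/andP: ai => /forallP/(_ j)/implyP/(_ j2)/eqP.
have -> : (\prod_(j < e.+2 | (2 <= j)%N) (i j)`! = \prod_(j < e.+2) (i j)`!)%N.
  rewrite big_mkcond; apply: eq_bigr => j _; by case: leqP => // /ij0 ->.
rewrite big_split /= [X in _ = _ * (_ * X)]split_prod; last by move=> j /ij0 ->.
have -> : gcoef (@ord_max e.+1) = t_series e.
  by rewrite /gcoef /= ltnNge ltnS e_gt0 eqxx.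
have -> : \prod_(j < e.+2 | (1 < j <= e)%N) gcoef j ^+ i j = \prod_(j < e.+2 | (1 < j <= e)%N)
    (x * 'C(e + 2, j)%:R - 'C(e, j.-1)%:R) ^+ i j.
  apply: eq_bigr => j /andP[j2 je]; congr (_ ^+ _).
  by rewrite /gcoef ltnNge j2 /= ifN // neq_ltn ltnS je.
move: (\prod_(j < e.+2 | _) _) (t_series e ^+ _) => P T.
have fu m : (m`!%:R : R) \is a GRing.unit by apply: fact_unit; exact: fps_nat_unit.
rewrite prodrV => [|j _]; last exact: fu.
rewrite natrM invrM ?fu //; last by rewrite natr_prod; apply: rpred_prod => j _; exact: fu.
rewrite natr_prod; move: ((\prod_(j < e.+2) _)^-1) => Q.
have kn : (k <= n.+1)%N by apply: ltnW.
rewrite -{1}(bin_fact kn) !natrM.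
have := mulVr (fu (n.+1 - k)%N); move: (_`!%:R) => a.
move: (a^-1) => a' aa; ring: aa.
Qed.
End Summand.

(** * The algebraic equation of the fixed point *)

(** Both equations are related by the change of variable [s = L / (1 + L)], after
    multiplication by [(1 - s) (1 + L)^(e+2)]. *)
Lemma kernel_equation (R : comUnitRingType) (e : nat) (x L : R) (s := L / (1 + L)) :
  1 + L \is a GRing.unit ->
  (1 - x) * (L * (1 + L) ^+ e - x * (1 + L) ^+ e.+2) = x * L ^+ e.+1 * (x - (1 - x) * L) ->
  (1 - x) * (s - x) = x * s + x * (s - x) * \sum_(i < e) s ^+ i.+1.
Proof.
move=> uL eqL.
have us : s * (1 + L) = L by rewrite /s mulrVK.
have u1s : (1 - s) * (1 + L) = 1 by rewrite mulrBl us mul1r addrK.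
have usn n : s ^+ n * (1 + L) ^+ n = L ^+ n by rewrite -exprMn us.
have geom : (1 - s) * (\sum_(i < e) s ^+ i.+1) = s - s ^+ e.+1.
  elim: {eqL} e => [|n IH]; first by rewrite big_ord0 mulr0 expr1 subrr.
  by rewrite big_ord_recr /= mulrDr IH [s ^+ n.+2]exprS; ring.
apply: (mulrI (unitrX e.+2 uL)).
have u1 : 1 - s \is a GRing.unit by apply/unitrPr; exists (1 + L).
apply: (mulrI u1).
transitivity ((1 - x) * (s * (1 + L) - x * (1 + L)) * ((1 - s) * (1 + L)) * (1 + L) ^+ e).
  by rewrite !exprS; ring.
rewrite u1s us.
transitivity (x * (s * (1 + L)) * ((1 - s) * (1 + L)) * (1 + L) ^+ e
   + x * (s * (1 + L) - x * (1 + L)) *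
     (((1 - s) * (\sum_(i < e) s ^+ i.+1)) * (1 + L) ^+ e.+1)); last first.
  by rewrite !exprS; ring.
rewrite geom u1s [(s - _) * _]mulrBl usn us [in s * _]exprS [in s * _]mulrA us.
have {eqL} : (1 - x) * (L * (1 + L) ^+ e - x * (1 + L) * (1 + L) * (1 + L) ^+ e)
    = x * L ^+ e.+1 * (x - (1 - x) * L).
  by rewrite -eqL !exprS; ring.
move: ((1 + L) ^+ e) (L ^+ e.+1) => m P /eqP; rewrite -subr_eq0 => /eqP eq0.
apply/eqP; rewrite -subr_eq0 -eq0; apply/eqP; ring.
Qed.

Section FixPoint.
Variable e : nat.
Hypothesis e_gt0 : (0 < e)%N.
Local Notation x := (fpsX rat).
Local Notation R := {fps rat}.

Lemma phi_poly0 : fps_ord 1 (phi_poly e)`_0.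
Proof.
rewrite coefZ coefD coefC /= /nonconst_poly coef_sum big1 ?addr0 => [|j _].
  by apply: fps_ordMl; exact: fps_ord_x.
rewrite coefZ coefXn /gcoef; case: ifP; first by rewrite mul0r.
by case: j => -[|j] //= _ _; rewrite mulr0.
Qed.

Lemma phi_poly1 : (phi_poly e)`_1 = 0.
Proof.
rewrite coefZ coefD coefC /= /nonconst_poly coef_sum big1 ?addr0 ?mulr0 // => j _.
rewrite coefZ coefXn /gcoef; case: ifP; first by rewrite mul0r.
by case: j => -[|[|j]] //= _ _; rewrite mulr0.
Qed.

(** In degrees 2 to [e], the coefficients of [(1 - (e+2)x) phi(z)] are those of
    [x (1+z)^(e+2) - z (1+z)^e]; the two sums [A] and [B] below disappear in this way. *)
Lemma fixpoint_equation (L : R) : L = (phi_poly e).[L] ->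
  (1 - x) * (L * (1 + L) ^+ e - x * (1 + L) ^+ e.+2) = x * L ^+ e.+1 * (x - (1 - x) * L).
Proof.
rewrite hornerZ hornerD hornerC /nonconst_poly horner_sum.
under eq_bigr do rewrite hornerZ hornerXn.
move=> /(congr1 (fun f => (1 - (e + 2)%:R * x) * f)); rewrite mulVKr ?fps_unit_1BX //.
case: e e_gt0 => // k _.
have exp1D n : (1 + L) ^+ n = \sum_(j < n.+1) L ^+ j * 'C(n, j)%:R.
  by rewrite exprDn; apply: eq_bigr => j _; rewrite expr1n mul1r mulr_natr.
pose A := \sum_(i < k) L ^+ i.+2 * 'C(k.+3, i.+2)%:R.
pose B := \sum_(i < k) L ^+ i.+2 * 'C(k.+1, i.+1)%:R.
have -> : (1 + L) ^+ k.+3 = 1 + L * k.+3%:R + A + L ^+ k.+2 * k.+3%:R + L ^+ k.+3.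
  rewrite exp1D 2!big_ord_recl 2!big_ord_recr /= /bump /= !add1n bin0 bin1 binn.
  by rewrite binSn /A expr0 expr1 !mulr1 !addrA.
have -> : L * (1 + L) ^+ k.+1 = L + B + L ^+ k.+2.
  rewrite exp1D big_ord_recl big_ord_recr /= bin0 binn expr0 !mulr1 !mulrDr mulr1 -exprS addrA.
  by rewrite /B mulr_sumr; congr (_ + _ + _); apply: eq_bigr => i _; rewrite mulrA -exprS.
have -> : \sum_(j < k.+3) gcoef k.+1 j * L ^+ j = x * A - B + t_series k.+1 * L ^+ k.+2.
  rewrite 2!big_ord_recl big_ord_recr /= !mul0r !add0r /gcoef /= /bump /= !add1n eqxx.
  rewrite /A /B mulr_sumr -sumrB; congr (_ + _); apply: eq_bigr => i _.
  rewrite add1n ifN; last by rewrite neq_ltn !ltnS ltn_ord.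
  by rewrite /= addn2; ring.
have ut : (1 - x) * t_series k.+1 = (k.+3)%:R * x * (1 - x) - 1 + x * (1 + x).
  by rewrite /t_series addn2 mulrC mulrVK // -[X in 1 - X]mul1r fps_unit_1BX.
rewrite addn2 => eqL.
have {eqL} : (1 - x) * ((1 - k.+3%:R * x) * L) =
    (1 - x) * (x + (x * A - B)) + ((1 - x) * t_series k.+1) * L ^+ k.+2.
  by rewrite eqL; ring.
rewrite ut [L ^+ k.+3]exprS.
move: (L ^+ k.+2) A B (k.+3%:R) => P A B K /eqP; rewrite -subr_eq0 => /eqP eq0.
apply/eqP; rewrite -subr_eq0 -eq0; apply/eqP; ring.
Qed.
End FixPoint.

(** * An automaton reading d-Dyck paths *)

Section Words.
Local Open Scope nat_scope.

(** The words of length [k], each listed once. *)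
Fixpoint words k : seq (seq bool) :=
  if k is k'.+1 then [seq rcons w b | w <- words k', b <- [:: true; false]]
  else [:: [::]].

Lemma wordsS k :
  words k.+1 = [seq rcons w b | w <- words k, b <- [:: true; false]].
Proof. by []. Qed.

Lemma mem_words k w : (w \in words k) = (size w == k).
Proof.
elim: k w => [|k IH] w; first by rewrite inE; case: w.
rewrite wordsS; apply/allpairsPdep/idP => [[v [b [vk _ ->]]]|].
  by rewrite size_rcons eqSS -IH.
case/lastP: w => // w b; rewrite size_rcons eqSS => wk.
by exists w, b; rewrite IH; split => //; rewrite !inE; case: b.
Qed.

Lemma uniq_words k : uniq (words k).
Proof.
elim: k => // k IH; rewrite wordsS; apply: allpairs_uniq => //.
by move=> [u a] [v b] _ _ /= /rcons_inj [-> ->].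
Qed.

Lemma card_tuple_words k (Q : pred (seq bool)) :
  #|[set w : k.-tuple bool | Q w]| = \sum_(w <- words k) Q w.
Proof.
rewrite -sum1_card big_mkcond /=.
rewrite (eq_bigr (fun w : k.-tuple bool => nat_of_bool (Q w))) => [|w _]; last first.
  by rewrite inE; case: (Q w).
rewrite -[LHS](big_map val predT (fun w => nat_of_bool (Q w))).
apply: perm_big; apply: uniq_perm.
- by rewrite map_inj_uniq ?index_enum_uniq //; exact: val_inj.
- exact: uniq_words.
move=> w; rewrite mem_words; apply/mapP/idP => [[v _ ->]|/eqP wk].
  by rewrite size_tuple.
by exists (Tuple (introT eqP wk)); rewrite ?mem_index_enum.
Qed.

Lemma sum_wordsS k (G : seq bool -> nat) :
  \sum_(w <- words k.+1) G w =
  \sum_(w <- words k) G (rcons w true) + \sum_(w <- words k) G (rcons w false).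
Proof.
rewrite big_allpairs_dep -big_split; apply: eq_bigr => w _ /=.
by rewrite !big_cons big_nil addn0.
Qed.

Variable e : nat.

(** Last step (true for up), height, level of the last valley. *)
Definition state := (bool * nat * nat)%type.

(** An up step after a down step creates a valley, which is accepted when its level
    is at least the previous one minus [e]; [None] is the failure state. *)
Definition transition (q : option state) (b : bool) : option state :=
  if q is Some (up, h, v) then
    if b then
      if up then Some (true, h.+1, v)
      else if v <= h + e then Some (true, h.+1, h) else None
    else if h is h'.+1 then Some (false, h', v) else None
  else None.

(** The origin is treated as reached by a down step, after a valley of level 0:
    the first step U then creates a spurious valley of level 0, which never
    constrains the next one. *)
Definition run (w : seq bool) : option state :=
  foldl transition (Some (false, 0, 0)) w.

Lemma run_rcons w b : run (rcons w b) = transition (run w) b.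
Proof. by rewrite /run foldl_rcons. Qed.

(** Number of words of length [k] that lead to the state [q]. *)
Definition num_run k (q : state) : nat := \sum_(w <- words k) (run w == Some q).

Lemma num_run0 q : num_run 0 q = (q == (false, 0, 0)).
Proof. by rewrite /num_run /= big_seq1 eq_sym. Qed.

Lemma num_run_up0 k v : num_run k (true, 0, v) = 0.
Proof.
case: k => [|k]; first by rewrite num_run0.
rewrite /num_run sum_wordsS !big1 // => w _; rewrite run_rcons; case: (run w) => [[[up h] v']|] //=.
  by case: h.
by case: up => //; case: ifP.
Qed.

Lemma some_state_eq (a a' : bool) (h h' v v' : nat) :
  (Some (a, h, v) == Some (a', h', v')) = [&& a == a', h == h' & v == v'].
Proof. by rewrite -[LHS]/((a, h, v) == (a', h', v')) !xpair_eqE andbA. Qed.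

Lemma transition_up_eq q h v :
  (transition q true == Some (true, h.+1, v)) =
  (q == Some (true, h, v)) +
  (if h == v then \sum_(v' < (v + e).+1) (q == Some (false, v, v' : nat)) else 0)
  :> nat.
Proof.
case: q => [[[up h'] v']|] /=; last by case: ifP => // _; rewrite big1.
rewrite some_state_eq; under eq_bigr do rewrite some_state_eq.
case: up => /=.
  rewrite some_state_eq /= eqSS (_ : (if _ then _ else _) = 0) ?addn0 //.
  by case: ifP => // _; rewrite big1.
have -> : \sum_(i < (v + e).+1) ((h' == v) && (v' == i)) = (h' == v) && (v' <= v + e).
  case: (leqP v' (v + e)) => [le|gt].
    rewrite (bigD1 (Ordinal (le : v' < (v + e).+1))) //= eqxx big1 ?addn0 //.
    by move=> i; rewrite -val_eqE /= eq_sym => /negbTE ->; rewrite andbF.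
  rewrite andbF big1 // => i _; have := ltn_ord i.
  by case: (v' =P i) => [<-|]; rewrite ?andbF // ltnS leqNgt gt.
rewrite add0n; case: (leqP v' (h' + e)) => le.
  rewrite some_state_eq /= eqSS; case: (altP (h =P v)) => [<-|hv].
    by case: (altP (h' =P h)) => [<-|]; rewrite ?le.
  by case: (altP (h' =P v)) => [->|]; rewrite ?andbF // eq_sym (negbTE hv).
case: ifP => // _; case: (altP (h' =P v)) => [<-|] //.
by rewrite leqNgt le.
Qed.

Lemma num_run_upS k h v : num_run k.+1 (true, h.+1, v) =
  num_run k (true, h, v) +
  (if h == v then \sum_(v' < (v + e).+1) num_run k (false, v, v' : nat) else 0).
Proof.
rewrite /num_run sum_wordsS [X in _ + X]big1 ?addn0 => [|w _]; last first.
  by rewrite run_rcons; case: (run w) => [[[up [|h']] v']|].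
rewrite exchange_big /= -[if _ then _ else _]/(if h == v then _ else _).
pose M w := \sum_(v' < (v + e).+1) (run w == Some (false, v, v' : nat)).
have -> : (if h == v then \sum_(w <- words k) M w else 0)
  = \sum_(w <- words k) (if h == v then M w else 0).
  by case: ifP => // _; rewrite big1.
rewrite -big_split; apply: eq_bigr => w _; rewrite run_rcons /=.
exact: transition_up_eq.
Qed.

Lemma num_run_downS k h v : num_run k.+1 (false, h, v) =
  num_run k (true, h.+1, v) + num_run k (false, h.+1, v).
Proof.
rewrite /num_run sum_wordsS big1 ?add0n => [|w _]; last first.
  by rewrite run_rcons; case: (run w) => [[[[] h'] v']|] //=; case: ifP.
rewrite -big_split; apply: eq_bigr => w _; rewrite run_rcons /=.
by case: (run w) => [[[[] [|h']] v']|] //=; rewrite ?addn0 ?add0n;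
  congr nat_of_bool; apply/eqP/eqP => -[-> ->].
Qed.

Lemma run_bounds w up h v : run w = Some (up, h, v) -> h <= size w /\ v <= size w.
Proof.
elim/last_ind: w up h v => [|w b IH] up h v; first by case=> _ <- <-.
rewrite run_rcons size_rcons; case: (run w) IH => [[[up' h'] v']|] //= /(_ _ _ _ erefl) [hw vw].
case: b => [|]; last by case: h' hw => // h' hw [_ <- <-]; lia.
case: up' => [[_ <- <-]|]; first lia.
by case: ifP => // _ [_ <- <-]; lia.
Qed.

Lemma num_run_eq0 k up h v : k < h -> num_run k (up, h, v) = 0.
Proof.
move=> kh; rewrite /num_run big_seq big1 // => w; rewrite mem_words => /eqP wk.
by case: eqP => // /run_bounds [hw _]; rewrite -wk ltnNge hw in kh.
Qed.
End Words.

Section Spec.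
Variable d : int.
Hypothesis d_lt0 : d < 0.
Local Notation e := (absz d).

Lemma height_rcons w (b : bool) : height (rcons w b) = height w + (if b then 1 else - 1).
Proof.
rewrite /height /U /D -!cats1 !count_cat /=; case: b => /=; lia.
Qed.

Lemma valley_levels_rcons w (b : bool) : valley_levels (rcons w b) =
  if [&& w != [::], ~~ last false w & b] then rcons (valley_levels w) (height w)
  else valley_levels w.
Proof.
case: w => [|a w]; first by [].
set s := a :: w; have ss : size s = (size w).+1 by [].
rewrite /valley_levels size_rcons ss -pred_Sn -pred_Sn.
rewrite -[(size w).+1]addn1 iotaD filter_cat map_cat add0n.
rewrite (@eq_in_filter _ _ (fun k => (nth U s k == D) && (nth U s k.+1 == U))); last first.
  by move=> k; rewrite mem_iota => /andP[_ kw]; rewrite !nth_rcons ss !ifT //; lia.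
set F := [seq k <- iota 0 (size w) | _].
have -> : [seq height (take k.+1 (rcons s b)) | k <- F] = [seq height (take k.+1 s) | k <- F].
  apply/eq_in_map => k; rewrite mem_filter mem_iota => /andP[_ /andP[_ kw]].
  by rewrite -cats1 takel_cat // ss; lia.
have lastE : nth U s (size w) = last false s.
  by rewrite (last_nth U) /=.
have -> : s != [::] by [].
move: {F} [seq _ | k <- F] => T; move: (s) ss lastE => {a} s ss lastE.
rewrite [iota _ 1]/= [filter _ [:: _]]/= !nth_rcons ss ltnSn ltnn eqxx.
rewrite lastE.
have takeE : take (size w).+1 (rcons s b) = s by rewrite -cats1 take_size_cat.
by rewrite /D /U; case: (last false s); case: (b) takeE; rewrite ?cats0 ?cats1 //= => ->.
Qed.

(** The words that never go below the axis and satisfy the condition on valleys, where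
    a valley of level 0 is added in front. *)
Definition dDyck_prefix (w : seq bool) : bool :=
  all (fun k => 0 <= height (take k w)) (iota 0 (size w).+1) &&
  path (fun a b : int => d <= b - a) 0 (valley_levels w).

Lemma dDyck_prefix_rcons w (b : bool) : dDyck_prefix (rcons w b) =
  [&& dDyck_prefix w, 0 <= height (rcons w b) &
   [&& w != [::], ~~ last false w & b] ==> (d <= height w - last 0 (valley_levels w))].
Proof.
rewrite /dDyck_prefix size_rcons -[(size w).+2]addn1 iotaD all_cat add0n [all _ (iota _ 1)]/= andbT.
rewrite take_oversize ?size_rcons //.
rewrite (@eq_in_all _ _ (fun k => 0 <= height (take k w)) (iota 0 (size w).+1)); last first.
  by move=> k; rewrite mem_iota => /andP[_ kw]; rewrite -cats1 takel_cat //; lia.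
rewrite valley_levels_rcons; case: ifP => _; rewrite ?rcons_path ?implyTb ?implyFb ?andbT.
  by rewrite -!andbA; do !bool_congr.
by rewrite -!andbA; do !bool_congr.
Qed.

(** The automaton rejects exactly the words that are not prefixes of [d]-Dyck paths,
    and its state is the one announced; [last] returns 0 when there is no valley. *)
Lemma run_spec w :
  match run e w with
  | Some (up, h, v) => [/\ dDyck_prefix w, last false w = up, height w = h
                         & last 0 (valley_levels w) = v]
  | None => ~~ dDyck_prefix w
  end.
Proof.
elim/last_ind: w => [|w b]; first by [].
rewrite run_rcons; case: (run e w) (run_bounds (e := e) (w := w)) => [[[up h] v]|] /=; last first.
  by move=> _ /negbTE nw; rewrite dDyck_prefix_rcons nw.
move=> /(_ _ _ _ erefl) [hw vw] [Pw lw Hw Vw].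
case: b => /=.
  case: up lw => lw.
    rewrite dDyck_prefix_rcons valley_levels_rcons last_rcons height_rcons.
    by rewrite Pw Hw Vw lw andbF /=; split => //; lia.
  case: ifP => vh.
    rewrite dDyck_prefix_rcons valley_levels_rcons last_rcons height_rcons Pw Hw Vw lw /=.
    split=> //; try lia.
    case: w {Pw lw} hw vw Hw Vw => [|a w] /= hw vw Hw Vw; last by rewrite last_rcons.
    by lia.
  rewrite dDyck_prefix_rcons Pw Hw Vw lw /=; apply/negP => /andP[_ /implyP].
  case: w {Pw lw} hw vw Hw Vw => [|a w] /= hw vw Hw Vw; first by lia.
  by move=> /(_ isT); lia.
case: h hw Hw => [|h] hw Hw.
  by rewrite dDyck_prefix_rcons height_rcons Hw /= andbF.
rewrite dDyck_prefix_rcons valley_levels_rcons last_rcons height_rcons Pw Hw Vw !andbF /=.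
by split => //; lia.
Qed.

Lemma valley_levels_ge0 w : all (fun k => 0 <= height (take k w)) (iota 0 (size w).+1) ->
  all (fun l => 0 <= l) (valley_levels w).
Proof.
move=> /allP pos; apply/allP => l /mapP[k]; rewrite mem_filter mem_iota => /andP[_ kw] ->.
by apply: pos; rewrite mem_iota; lia.
Qed.

(** As [d < 0] and levels are nonnegative, the added valley of level 0 imposes no
    constraint on the first one. *)
Lemma is_dDyckE w : is_dDyck d w = dDyck_prefix w && (height w == 0).
Proof.
rewrite /is_dDyck /is_dyck /dDyck_prefix -andbA [(height w == 0) && _]andbC andbA.
congr (_ && _); have [pos|] := boolP (all _ (iota 0 _)); last by [].
have := valley_levels_ge0 pos; case: (valley_levels w) => //= l s /andP[l0 _].
by rewrite (_ : d <= l - 0) //; lia.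
Qed.

Lemma run_up_gt0 w h v : run e w = Some (true, h, v) -> (0 < h)%N.
Proof.
case/lastP: w => // w b; rewrite run_rcons; case: (run e w) => [[[up h'] v']|] //=.
by case: b; [case: up => [[<-]|] //; case: ifP => // _ [<-] | case: h'].
Qed.

Lemma is_dDyck_run n w : size w = n.*2 ->
  is_dDyck d w && (semilength w == n) =
  (\sum_(v < n.*2.+1) (run e w == Some (false, 0, v : nat)))%N :> nat.
Proof.
move=> wn.
have -> : is_dDyck d w && (semilength w == n) = is_dDyck d w.
  case: (boolP (is_dDyck d w)) => //= /andP[/size_dyck wE _].
  by apply/eqP; lia.
rewrite is_dDyckE; have := run_spec w; case E : (run e w) => [[[up h] v]|].
  move=> [-> _ -> _] /=; under eq_bigr do rewrite some_state_eq.
  have [h0|h0] := boolP (h == 0%N); last first.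
    by rewrite big1 => [|v' _]; [case: h h0 {E} | rewrite andbF].
  have -> : up = false by case: up E => // /run_up_gt0; rewrite (eqP h0).
  have [_ vw] := run_bounds E; rewrite wn -ltnS in vw.
  rewrite (eqP h0) /= (bigD1 (Ordinal vw)) //= !eqxx big1 // => i.
  by rewrite -val_eqE /= eq_sym => /negbTE ->.
by move=> /negbTE -> /=; rewrite big1.
Qed.

Lemma num_dDyck_run n :
  num_dDyck d n = (\sum_(v < n.*2.+1) num_run e n.*2 (false, 0, v : nat))%N.
Proof.
rewrite /num_dDyck (card_tuple_words _ (fun w => is_dDyck d w && (semilength w == n))).
rewrite exchange_big /= [LHS]big_seq [RHS]big_seq; apply: eq_bigr => w.
by rewrite mem_words => /eqP /is_dDyck_run.
Qed.
End Spec.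

(** * Generating functions of prefixes *)

Section GF.
Variable e : nat.
Local Notation x := (fpsX rat).
Local Notation R := {fps rat}.

(** Words leading to a state, counted by number [u] of up steps: a word of height
    [h] with [u] up steps has length [2u - h].  When [h > 2u] the subtraction is
    truncated to 0, and the only word, the empty one, does not have height [h]. *)
Definition state_gf (up : bool) (h v : nat) : R :=
  FPS (fun u => (num_run e (u.*2 - h) (up, h, v))%:R).

(** Words after which an up step creates an accepted valley of level [w]. *)
Definition valley_gf (w : nat) : R := \sum_(v < (w + e).+1) state_gf false w v.

Lemma state_gf_upS h v : state_gf true h.+1 v =
  x * (state_gf true h v + (if h == v then valley_gf v else 0)).
Proof.
apply: fpsP => u; rewrite fps_XmulE.
case: u => [|u]; first by rewrite /= num_run0.
have -> : (state_gf true h v + (if h == v then valley_gf v else 0)) u =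
   (num_run e (u.*2 - h) (true, h, v) +
   (if h == v then \sum_(v' < (v + e).+1) num_run e (u.*2 - h) (false, v, v' : nat) else 0))%N%:R.
  rewrite natrD.
  change (state_gf true h v u + (if h == v then valley_gf v else 0 : R) u =
   (num_run e (u.*2 - h) (true, h, v))%:R +
   (if h == v then \sum_(v' < (v + e).+1) num_run e (u.*2 - h) (false, v, v' : nat) else 0)%N%:R).
  congr (_ + _); case: eqP => [->|_]; last by case: u.
  by rewrite fps_sumE natr_sum.
rewrite -num_run_upS /=; have [hu|uh] := leqP h u.*2.
  by rewrite (_ : (u.+1.*2 - h.+1 = (u.*2 - h).+1)%N) //; lia.
rewrite (_ : (u.+1.*2 - h.+1 = 0)%N); last by lia.
rewrite (_ : (u.*2 - h = 0)%N); last by lia.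
rewrite num_run0 num_run_upS num_run0 /=; case: eqP => // hv.
rewrite big1 // => i _; rewrite num_run0 !xpair_eqE (_ : (v == 0%N) = false) ?andbF //.
by apply/negbTE; rewrite -lt0n -hv; lia.
Qed.

Lemma state_gf_up0 v : state_gf true 0 v = 0.
Proof. by apply: fpsP => u /=; rewrite num_run_up0; case: u. Qed.

Lemma state_gf_down h v : state_gf false h v =
  ((h == 0%N) && (v == 0%N))%:R + state_gf true h.+1 v + state_gf false h.+1 v.
Proof.
apply: fpsP => u.
change (state_gf false h v u = (((h == 0%N) && (v == 0%N))%:R : R) u
  + state_gf true h.+1 v u + state_gf false h.+1 v u).
rewrite fps_natE /=; have [hu|uh] := ltnP h u.*2.
  rewrite (_ : (u.*2 - h = (u.*2 - h.+1).+1)%N); last by lia.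
  by rewrite num_run_downS natrD ifN ?add0r //; lia.
rewrite (_ : (u.*2 - h = 0)%N); last by lia.
rewrite (_ : (u.*2 - h.+1 = 0)%N); last by lia.
rewrite !num_run0 !addr0; case: u uh => [|u] //=; by case: h.
Qed.

Lemma state_gf_up h v :
  state_gf true h v = if (v < h)%N then x ^+ (h - v) * valley_gf v else 0.
Proof.
elim: h => [|h IH]; first by rewrite state_gf_up0.
rewrite state_gf_upS IH ltnS; case: (ltngtP v h) => [vh|vh|->].
- by rewrite addr0 mulrA -exprS subSn // ltnW.
- by rewrite addr0 mulr0.
- by rewrite subSnn add0r.
Qed.

Lemma state_gf_down_ord h v u : (u < h)%N -> state_gf false h v u = 0.
Proof. by move=> uh /=; rewrite num_run_eq0 //; lia. Qed.

Lemma state_gf_downE h v : (1 - x) * state_gf false h v =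
  (1 - x) * ((h == 0%N) && (v == 0%N))%:R + x ^+ ((maxn h v).+1 - v) * valley_gf v.
Proof.
(* The defect E of the identity does not depend on h, and it tends to 0. *)
pose E h := (1 - x) * state_gf false h v -
  ((1 - x) * ((h == 0%N) && (v == 0%N))%:R + x ^+ ((maxn h v).+1 - v) * valley_gf v).
have ES k : E k = E k.+1.
  rewrite /E state_gf_down state_gf_up ltnS.
  rewrite (_ : ((k.+1 == 0%N) && (v == 0%N))%:R = 0 :> R) //; case: leqP => vk.
    rewrite (maxn_idPl (leqW vk)) !subSn //; last exact: leqW.
    rewrite !exprS; ring.
  rewrite (maxn_idPr vk); ring.
have E0 : E h = 0.
  apply: fps_ord_eq0 => m.
  have -> : E h = E (h + (m + v).+1)%N by elim: (m + v).+1 => [|k ->]; rewrite ?addn0 // addnS.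
  rewrite /E; apply: fps_ordB.
    by apply: fps_ordMl => i im; apply: state_gf_down_ord; lia.
  rewrite addnS /= mulr0 add0r mulrC; apply: fps_ordMl.
  by apply: (fps_ordW (@fps_ord_xn _ _)); lia.
by apply/eqP; rewrite -subr_eq0 -/(E h) E0.
Qed.

Lemma valley_gf_rec w : (1 - x) * valley_gf w = (1 - x) * (w == 0%N)%:R +
  \sum_(v < (w + e).+1) x ^+ ((maxn w v).+1 - v) * valley_gf v.
Proof.
rewrite mulr_sumr; under eq_bigr do rewrite state_gf_downE.
rewrite big_split /= big_ord_recl big1 ?addr0 ?andbT // => i _.
by rewrite andbF mulr0.
Qed.

(** All the coefficients of the system are divisible by [x]. *)
Lemma valley_rec_unique (G : nat -> R) :
  (forall w, (1 - x) * G w = \sum_(v < (w + e).+1) x ^+ ((maxn w v).+1 - v) * G v) ->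
  forall w, G w = 0.
Proof.
move=> recG.
have ux : 1 - x \is a GRing.unit by rewrite -[x]mul1r fps_unit_1BX.
suff H m w : fps_ord m (G w) by move=> w; apply: fps_ord_eq0.
elim: m w => [|m IH] w; first exact: fps_ord0.
rewrite -[G w](mulKr ux) recG; apply: fps_ordMl; apply: fps_ord_sum => v _.
rewrite -add1n; apply: fps_ordM (IH v).
by apply: (fps_ordW (@fps_ord_xn _ _)); lia.
Qed.

(** The kernel method in closed form: the candidate [J] satisfies the system of
    [valley_gf_rec], multiplied by [x] to avoid the denominator of [s/x - 1]. *)
Lemma valley_gfE (s : R) (w : nat) :
  (1 - x) * (s - x) = x * s + x * (s - x) * \sum_(i < e) s ^+ i.+1 ->
  x * valley_gf w = x * (w == 0%N)%:R + (s - x) * s ^+ w.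
Proof.
move=> kernel.
pose J w := x * (w == 0%N)%:R + (s - x) * s ^+ w.
have sumJ k : \sum_(v < k.+1) x ^+ (k - v) * J v = s ^+ k.+1.
  elim: k => [|k IH].
    by rewrite big_ord1 /J /= !expr0 expr1; ring.
  rewrite big_ord_recr /= subnn expr0 mul1r.
  under eq_bigr => v _ do rewrite subSn -1?ltnS // exprS -mulrA.
  by rewrite -mulr_sumr IH /J mulr0 add0r [s ^+ k.+2]exprS; ring.
apply/eqP; rewrite -subr_eq0; apply/eqP.
apply: (@valley_rec_unique (fun w => x * valley_gf w - J w)) => {}w.
rewrite mulrBr mulrCA valley_gf_rec mulrDr.
under [RHS]eq_bigr do rewrite mulrBr mulrCA.
rewrite sumrB -mulr_sumr.
suff -> : (1 - x) * J w = x * ((1 - x) * (w == 0%N)%:R)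
   + \sum_(v < (w + e).+1) x ^+ ((maxn w v).+1 - v) * J v by ring.
have -> : \sum_(v < (w + e).+1) x ^+ ((maxn w v).+1 - v) * J v
  = x * s ^+ w.+1 + x * (s - x) * (\sum_(i < e) s ^+ i.+1) * s ^+ w.
  rewrite -addSn big_split_ord /= -sumJ; congr (_ + _).
    rewrite mulr_sumr; apply: eq_bigr => v _.
    have vw : (v <= w)%N by rewrite -ltnS.
    by rewrite (maxn_idPl vw) subSn // exprS mulrA.
  rewrite mulr_sumr mulr_suml; apply: eq_bigr => i _.
  rewrite (maxn_idPr _); last by lia.
  by rewrite subSnn expr1 /J /= mulr0 add0r addSn -addnS exprD; ring.
rewrite /J mulrDr [(1 - x) * ((s - x) * _)]mulrA kernel exprS; ring.
Qed.

(** When [s] has no constant term, letting [N] grow shows that the complete paths,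
    empty path included, are counted by [1 / (1 - s)]. *)
Lemma sum_state_gf (s : R) (N : nat) :
  (1 - x) * (s - x) = x * s + x * (s - x) * \sum_(i < e) s ^+ i.+1 ->
  (1 - s) * (1 - x) * \sum_(v < N.+1) state_gf false 0 v = 1 - x - (s - x) * s ^+ N.+1.
Proof.
move=> kernel; rewrite -mulrA mulr_sumr.
have geom n : (1 - s) * (\sum_(v < n) s ^+ v) = 1 - s ^+ n.
  elim: n => [|n IH]; first by rewrite big_ord0 mulr0 subrr.
  by rewrite big_ord_recr /= mulrDr IH exprS; ring.
under eq_bigr do rewrite state_gf_downE /= max0n subSnn expr1 (valley_gfE _ kernel).
have -> : \sum_(v < N.+1) ((1 - x) * ((v : nat) == 0%N)%:R +
      (x * ((v : nat) == 0%N)%:R + (s - x) * s ^+ v))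
  = 1 + (s - x) * \sum_(v < N.+1) s ^+ v.
  under eq_bigr do rewrite addrA -mulrDl subrK mul1r.
  rewrite big_split /= mulr_sumr; congr (_ + _).
  by rewrite big_ord_recl big1 ?addr0.
rewrite mulrDr mulrCA geom; ring.
Qed.
End GF.

(** The generating function of the nonempty [d]-Dyck paths is the fixed point of
    [phi_poly] without constant term. *)
Lemma L_seriesE (d : int) (L : {fps rat}) : d < 0 -> fps_ord 1 L ->
  L = (phi_poly (absz d)).[L] -> L_series d = L.
Proof.
move=> d0 L1 /(fixpoint_equation _) eqL.
have e0 : (0 < absz d)%N by lia.
have uL : 1 + L \is a GRing.unit.
  rewrite fps_unitE unitfE; change (1 + L 0%N != 0); by rewrite L1 // addr0 oner_eq0.
have := kernel_equation uL (eqL e0); set s := L / (1 + L) => kernel.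
have us : 1 - s = (1 + L)^-1.
  by apply: (mulIr uL); rewrite mulrBl mulrVK // mulVr // mul1r addrK.
have ux : 1 - fpsX rat \is a GRing.unit by rewrite -[fpsX rat]mul1r fps_unit_1BX.
have s1 : fps_ord 1 s by rewrite /s mulrC; apply: fps_ordMl.
apply: fpsP => -[|n]; first by rewrite L1.
rewrite /= num_dDyck_run // natr_sum.
transitivity ((\sum_(v < n.+1.*2.+1) state_gf (absz d) false 0 v) n.+1).
  by rewrite fps_sumE; apply: eq_bigr => v _; rewrite /= subn0.
transitivity ((1 + L) n.+1); last exact: add0r.
apply: (@fps_ord_eq _ n.+2) => //.
have /(congr1 (fun f => (1 - fpsX rat)^-1 * ((1 + L) * f))) := sum_state_gf n.+1.*2 kernel.
rewrite us -mulrA mulVKr // mulKr // => ->.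
rewrite mulrBr mulrBr mulrCA mulVr // mulr1 addrAC subrr sub0r.
apply: fps_ordN; do 3 apply: fps_ordMl.
by apply: (fps_ordW (fps_ordX (k := n.+1.*2.+1) s1)); lia.
Qed.

Theorem theorem2p3 (d : int) (hd : d < 0) :
  let e : nat := absz d in
  fps_has_sum1 (summand e) (L_series d).
Proof.
move=> e; have e0 : (0 < e)%N by rewrite /e; lia.
have p0 := phi_poly0 e; have p1 := phi_poly1 e.
rewrite (@L_seriesE d (lagrange_sum (phi_poly e) 1)) //.
- move=> m; have [N HN] := lagrange_has_sum p0 p1 m; exists N => M /HN <-.
  congr (coef_fps _ m); apply: eq_big_nat => -[|n] // _.
  exact: summandE.
- exact: lagrange_sum_ord.
- exact: lagrange_fixpoint.
Qed.
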